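(* Let $r\ge1$ and let $G=\overline{\langle a_1,\dots,a_r\rangle}\subset W$ be the closed subgroup topologically generated by the elements $a_1,\dots,a_r\in W$ determined by $a_1=(a_r,1)\,\sigma$ and $a_i=(a_{i-1},1)$ for $2\le i\le r$. Then the Hausdorff dimension of $G$ exists and is $1-\frac{1}{2^r-1}$.
   Context: $T$ is the infinite rooted binary tree whose vertices are the finite words over $\{0,1\}$, with root the empty word, each word $t$ being joined by an edge to $t0$ and $t1$. $T_n\subset T$ is the finite subtree of words of length $\le n$. $W:=\operatorname{Aut}(T)$ is a profinite group as the inverse limit of the finite groups $W_n:=\operatorname{Aut}(T_n)$, and $|W_n|=2^{2^n-1}$. For $u,v\in W$, $(u,v)\in W$ denotes the automorphism $0t\mapsto 0\,u(t)$, $1t\mapsto 1\,v(t)$ for all words $t$; $\sigma\in W$ is the automorphism of order $2$ with $0t\mapsto 1t$ and $1t\mapsto 0t$. Thus $W=(W\times W)\rtimes\langle\sigma\rangle$. The recursion relations for $a_1,\dots,a_r$ have a unique solution in $W$. For a closed subgroup $G\subset W$ with image $G_n$ in $W_n$, the Hausdorff dimension of $G$ is $\lim_{n\to\infty}\frac{\log_2|G_n|}{\log_2|W_n|}=\lim_{n\to\infty}\frac{\log_2|G_n|}{2^n-1}$ if this limit exists. *)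

(* Defs.v *)
From HB Require Import structures.
From mathcomp Require Import all_boot all_order all_algebra all_fingroup.
From mathcomp Require Import all_classical all_reals all_analysis.

Set Implicit Arguments.
Unset Strict Implicit.
Unset Printing Implicit Defensive.

Import Order.TTheory GRing.Theory Num.Theory.
Import numFieldNormedType.Exports.

Local Open Scope classical_set_scope.

(* The vertices of the tree are the words over {0,1}, with false for the letter
   0 and true for the letter 1; the children of a word t are rcons t b. *)
Definition tree_edge (s t : seq bool) : bool :=
  [exists b : bool, (t == rcons s b) || (s == rcons t b)].

Definition is_tree_aut (f : seq bool -> seq bool) : Prop :=
  [/\ bijective f, f [::] = [::]
    & forall s t, tree_edge (f s) (f t) = tree_edge s t].

Record treeAut := TreeAut {
  tree_fun :> seq bool -> seq bool;
  tree_funP : `[< is_tree_aut tree_fun >]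
}.

HB.instance Definition _ := [isSub for tree_fun].
HB.instance Definition _ := [Choice of treeAut by <:].

Lemma treeAutP (w : treeAut) : is_tree_aut w.
Proof. exact/asboolP/tree_funP. Qed.

Lemma treeAut_eqP (v w : treeAut) : v =1 w -> v = w.
Proof. by move=> vw; apply/val_inj/funext. Qed.

Lemma tree_inv_subproof (w : treeAut) t : exists s, w s == t.
Proof. by case: (treeAutP w) => -[g _ gK] _ _; exists (g t); rewrite gK. Qed.

Definition tree_inv_fun (w : treeAut) t := xchoose (tree_inv_subproof w t).

Lemma tree_inv_funK (w : treeAut) : cancel (tree_inv_fun w) w.
Proof. by move=> t; apply/eqP/(xchooseP (tree_inv_subproof w t)). Qed.

Lemma tree_funK (w : treeAut) : cancel w (tree_inv_fun w).
Proof.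
by move=> s; apply: (bij_inj (let: And3 h _ _ := treeAutP w in h));
  rewrite tree_inv_funK.
Qed.

Lemma is_tree_aut_id : is_tree_aut id.
Proof. by split=> //; exists id. Qed.

Lemma is_tree_aut_comp (v w : treeAut) : is_tree_aut (v \o w).
Proof.
case: (treeAutP v) (treeAutP w) => [bv v0 ve] [bw w0 we]; split.
- exact: bij_comp.
- by rewrite /= w0.
- by move=> s t; rewrite /= ve we.
Qed.

Lemma is_tree_aut_inv (w : treeAut) : is_tree_aut (tree_inv_fun w).
Proof.
case: (treeAutP w) => [_ w0 we]; split.
- by exists w; [exact: tree_inv_funK|exact: tree_funK].
- by rewrite -{1}w0 tree_funK.
- by move=> s t; rewrite -we !tree_inv_funK.
Qed.

Definition tree_one : treeAut := TreeAut (asboolT is_tree_aut_id).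
Definition tree_inv (w : treeAut) : treeAut := TreeAut (asboolT (is_tree_aut_inv w)).
Definition tree_mul (v w : treeAut) : treeAut :=
  TreeAut (asboolT (is_tree_aut_comp v w)).

Lemma tree_mulA : associative tree_mul.
Proof. by move=> u v w; apply: treeAut_eqP. Qed.

Lemma tree_mul1g : left_id tree_one tree_mul.
Proof. by move=> w; apply: treeAut_eqP. Qed.

Lemma tree_mulg1 : right_id tree_one tree_mul.
Proof. by move=> w; apply: treeAut_eqP. Qed.

Lemma tree_mulVg : left_inverse tree_one tree_inv tree_mul.
Proof. by move=> w; apply: treeAut_eqP => t /=; rewrite tree_funK. Qed.

Lemma tree_mulgV : right_inverse tree_one tree_inv tree_mul.
Proof. by move=> w; apply: treeAut_eqP => t /=; rewrite tree_inv_funK. Qed.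

(* treeAut acts on words from the left: (v * w) t = v (w t). *)
HB.instance Definition _ := isGroup.Build treeAut
  tree_mulA tree_mul1g tree_mulg1 tree_mulVg tree_mulgV.

Definition pair_fun (u v : seq bool -> seq bool) (t : seq bool) : seq bool :=
  match t with
  | [::] => [::]
  | false :: t' => false :: u t'
  | true :: t' => true :: v t'
  end.

Definition swap_fun (t : seq bool) : seq bool :=
  match t with
  | [::] => [::]
  | b :: t' => ~~ b :: t'
  end.

Lemma tree_edge_nil t : tree_edge [::] t = (size t == 1)%N.
Proof.
apply/existsP/eqP => [[b /orP[/eqP->//|]]|]; first by case: t.
by case: t => [|b []]// _; exists b; rewrite eqxx.
Qed.

Lemma tree_edgeC s t : tree_edge s t = tree_edge t s.
Proof. by apply: eq_existsb => b; rewrite orbC. Qed.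

Lemma tree_edge_cons a b s t :
  tree_edge (a :: s) (b :: t) = (a == b) && tree_edge s t.
Proof.
apply/existsP/andP => [[c]|[/eqP-> /existsP[c]]].
  rewrite !rcons_cons !eqseq_cons => /orP[] /andP[/eqP-> h].
    by split=> //; apply/existsP; exists c; rewrite h.
  by split=> //; apply/existsP; exists c; rewrite h orbT.
by move=> h; exists c; rewrite !rcons_cons !eqseq_cons eqxx.
Qed.

Lemma size_tree_aut (f : seq bool -> seq bool) :
  is_tree_aut f -> forall t, size (f t) = size t.
Proof.
case=> bf f0 fe.
have neq2 m : m = m.+2 -> False by elim: m => // m IH [/IH].
have hn n : (forall s, (size s <= n)%N -> size (f s) = size s) ->
    forall s b, (size s <= n)%N -> size (f (rcons s b)) = (size s).+1.
  move=> IH s c sn.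
  have: tree_edge (f s) (f (rcons s c)).
    by rewrite fe; apply/existsP; exists c; rewrite eqxx.
  case/existsP=> d /orP[/eqP->|/eqP fs]; first by rewrite size_rcons IH.
  case/lastP: s => [|s e] in sn fs *.
    by move: fs; rewrite f0; case: (f _).
  have sn' : (size s <= n)%N by apply: leq_trans sn; rewrite size_rcons leqW.
  have: tree_edge (f s) (f (rcons s e)).
    by rewrite fe; apply/existsP; exists e; rewrite eqxx.
  case/existsP=> g /orP[/eqP fse|/eqP fse].
    move: fs; rewrite fse => /rcons_inj[fs _].
    have /(congr1 size) := bij_inj bf fs.
    by rewrite !size_rcons => e2; case: (neq2 _ e2).
  have e2 : size (f s) = (size (f (rcons s e))).+1 by rewrite fse size_rcons.
  by move: e2; rewrite (IH s sn') (IH _ sn) size_rcons => e2; case: (neq2 _ e2).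
have key n : forall s, (size s <= n)%N -> size (f s) = size s.
  elim: n => [|n IH]; first by case=> // _; rewrite f0.
  case/lastP=> [|s c]; first by rewrite f0.
  by rewrite size_rcons => sn; apply: hn IH _ _ sn.
by move=> t; apply: (key (size t)).
Qed.

Lemma size_treeAut (w : treeAut) t : size (w t) = size t.
Proof. exact: size_tree_aut (treeAutP w) t. Qed.

Lemma is_tree_aut_pair (u v : treeAut) : is_tree_aut (pair_fun u v).
Proof.
have edge_pair (x y : treeAut) s t : tree_edge (pair_fun x y s) (pair_fun x y t)
    = tree_edge s t.
  case: s t => [|[] s] [|[] t] //=; rewrite ?[tree_edge _ [::]]tree_edgeC
    ?tree_edge_nil ?tree_edge_cons //= ?size_treeAut //.
  - by case: (treeAutP y).
  - by case: (treeAutP x).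
split=> //.
exists (pair_fun (tree_inv u) (tree_inv v)) => -[|[] t] //=;
  by rewrite ?tree_funK ?tree_inv_funK.
Qed.

Lemma is_tree_aut_swap : is_tree_aut swap_fun.
Proof.
split=> //; first by exists swap_fun => -[|[]].
move=> [|a s] [|b t] //=; rewrite ?[tree_edge _ [::]]tree_edgeC
  ?tree_edge_nil ?tree_edge_cons //.
by case: a b => [] [].
Qed.

Definition tree_pair (u v : treeAut) : treeAut :=
  TreeAut (asboolT (is_tree_aut_pair u v)).

Definition sigma : treeAut := TreeAut (asboolT is_tree_aut_swap).

(* The vertices of the finite subtree of words of length at most n are the
   bounded sequences n.-bseq bool. *)
Definition fin_tree_aut (n : nat) : {set {perm n.-bseq bool}} :=
  [set p : {perm n.-bseq bool} | (p [bseq] == [bseq]) &&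
    [forall s, forall t, tree_edge (p s) (p t) == tree_edge s t]]%SET.

Lemma restr_subproof n (w : treeAut) (t : n.-bseq bool) : (size (w t) <= n)%N.
Proof. by rewrite size_treeAut size_bseq. Qed.

Definition restr_fun n (w : treeAut) (t : n.-bseq bool) : n.-bseq bool :=
  Bseq (restr_subproof w t).

Lemma restr_fun_inj n (w : treeAut) : injective (@restr_fun n w).
Proof.
move=> s t /(congr1 val)/= e; apply/val_inj.
by case: (treeAutP w) => /bij_inj winj _ _; apply: winj.
Qed.

Definition restr n (w : treeAut) : {perm n.-bseq bool} := perm (@restr_fun_inj n w).

Lemma restr_fin_tree_aut n w : restr n w \in fin_tree_aut n.
Proof.
case: (treeAutP w) => _ w0 we; rewrite inE; apply/andP; split.
  by apply/eqP/val_inj; rewrite permE /= w0.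
by apply/forallP => s; apply/forallP => t; rewrite !permE /= we.
Qed.

(* The profinite topology: it is induced by the product of the finite discrete
   automorphism groups of the subtrees. *)
Definition restr_all (w : treeAut) :
  prod_topology (fun n => discrete_topology {perm n.-bseq bool}) :=
  fun n => restr n w.

HB.instance Definition _ :=
  Topological.copy treeAut (initial_topology restr_all).

Definition generated_subgroup (A : set treeAut) : set treeAut :=
  smallest [set H : set treeAut | group_closed (mem H)] A.

Definition topologically_generated (A : set treeAut) : set treeAut :=
  closure (generated_subgroup A).

Definition fin_image n (G : set treeAut) : {set {perm n.-bseq bool}} :=
  [set p | p \in restr n @` G]%SET.

Definition log2 {R : realType} (x : R) : R := (ln x / ln 2)%R.

Definition has_hausdorff_dim {R : realType} (G : set treeAut) (d : R) : Prop :=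
  (fun n : nat => log2 (#|fin_image n G|%:R : R) /
                  log2 (#|fin_tree_aut n|%:R : R))%R @ \oo --> d.

(* Main.v *)
(* Write g = (x, y) sigma^b for an element of the discrete group generated by
   a_1, ..., a_r, and let e_i(g) be the exponent sum of a_i in a word spelling
   g.  The recursion turns a word for g into words for x and y with
     e_i(g) = e_(i-1)(x) + e_(i-1)(y)  (2 <= i <= r),
     e_1(g) = e_r(x) + e_r(y),  e_r(x) = e_r(y) + b,
   and conversely, whenever e_r(x) = e_r(y) + b, the element (x, y) sigma^b lies
   in the group.  If g is trivial on T_n then so are x and y on T_(n-1) and
   b = 0, so by induction 2^floor((n+r-i)/r) divides e_i(g); as a_r has order
   2^floor(n/r) on T_n, the exponent e_r is well defined on G_n exactly modulo
   2^floor(n/r).  Counting the pairs (x, y) gives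
     |G_(n+1)| * 2^floor(n/r) = 2 * |G_n|^2,
   whose solution is, with D = 1 - 1/(2^r-1),
     log2 |G_n| = D(2^n-1) + floor(n/r) + (2^(n mod r)-1)/(2^r-1). *)

Require Import Defs.
From mathcomp Require Import all_boot all_order all_algebra all_fingroup.
From mathcomp Require Import all_classical all_reals all_analysis.
From mathcomp Require Import ring lra zify.

Set Implicit Arguments.
Unset Strict Implicit.
Unset Printing Implicit Defensive.

Import Order.TTheory GRing.Theory Num.Theory.
Import numFieldNormedType.Exports.

Local Open Scope classical_set_scope.

(** * The decomposition of automorphisms at the root *)

Lemma treeAutM (v w : treeAut) t : (v * w)%g t = v (w t).
Proof. by []. Qed.

(** The element [(x, y) sigma^b]. As [sigma] acts first, [x] and [y] are indexed by the first letter
    of the image, hence the selector [c (+) b] in [branch_cons]. *)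
Definition branch (x y : treeAut) (b : bool) : treeAut :=
  (tree_pair x y * (if b then sigma else 1))%g.

Arguments branch (x y)%_group_scope b.

Lemma branch_cons x y b c t :
  branch x y b (c :: t) = c (+) b :: (if c (+) b then y t else x t).
Proof. by case: b c => [] []. Qed.

Lemma treeAut_nil (w : treeAut) : w [::] = [::].
Proof. by case: (treeAutP w). Qed.

Lemma branchM x y b x' y' b' :
  (branch x y b * branch x' y' b')%g =
  branch (x * (if b then y' else x'))%g (y * (if b then x' else y'))%g (b (+) b').
Proof.
apply: treeAut_eqP => -[|c t]; first by rewrite !treeAut_nil.
by rewrite treeAutM !branch_cons; case: b b' c => [] [] [].
Qed.

Lemma branch1 : branch 1 1 false = 1%g.
Proof. by apply: treeAut_eqP => -[|[] t]. Qed.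

Lemma branchV x y b :
  ((branch x y b)^-1)%g =
  branch (if b then y else x)^-1%g (if b then x else y)^-1%g b.
Proof.
apply: (mulgI (branch x y b)); rewrite mulgV branchM -branch1.
by case: b; rewrite /= !mulgV.
Qed.

(** * Restriction to finite subtrees *)

Definition agree n (v w : treeAut) := forall t, (size t <= n)%N -> v t = w t.

Lemma restr_eqP n v w : restr n v = restr n w <-> agree n v w.
Proof.
split=> [/permP vw t tn|vw].
  by have /(congr1 val) := vw (Bseq tn); rewrite !permE.
by apply/permP => t; rewrite !permE; apply/val_inj; rewrite /= vw ?size_bseq.
Qed.

(** The factors are exchanged because permutations compose from left to right, while [treeAut] acts
    from the left. *)
Lemma restrM n (v w : treeAut) : restr n (v * w)%g = (restr n w * restr n v)%g.
Proof. by apply/permP => t; rewrite permM !permE; apply/val_inj. Qed.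

Lemma restr1 n : restr n 1%g = 1%g.
Proof. by apply/permP => t; rewrite !permE; apply/val_inj. Qed.

Lemma agree_branch n x y b x' y' b' :
  agree n.+1 (branch x y b) (branch x' y' b') <->
  [/\ agree n x x', agree n y y' & b = b'].
Proof.
split=> [h|[xx' yy' <-] [|c t] tn]; last 2 first.
- by rewrite !treeAut_nil.
- by rewrite !branch_cons; case: ifP => _; rewrite ?xx' ?yy'.
have bb' : b = b'.
  by have := h [:: false] isT; rewrite !branch_cons => -[].
rewrite -{}bb' in h *; split=> // t tn.
(* The image of [b :: t] starts with [false], so this word sees [x]; its sibling [~~ b :: t] sees
   [y]. *)
- by have := h (b :: t) tn; rewrite !branch_cons addbb => -[].
- by have := h (~~ b :: t) tn; rewrite !branch_cons addNb addbb => -[].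
Qed.

Lemma tree_edge_rcons s b : tree_edge s (rcons s b).
Proof. by apply/existsP; exists b; rewrite eqxx. Qed.

Lemma treeAut_rcons (w : treeAut) s b : exists c, w (rcons s b) = rcons (w s) c.
Proof.
have [_ _ we] := treeAutP w.
have /existsP[c /orP[/eqP->|/eqP e]] : tree_edge (w s) (w (rcons s b)).
- by rewrite we tree_edge_rcons.
- by exists c.
- by have /(congr1 size) := e; rewrite size_rcons !size_treeAut size_rcons; lia.
Qed.

Lemma treeAut_prefix (w : treeAut) s t :
  exists2 u, size u = size t & w (s ++ t) = w s ++ u.
Proof.
elim/last_ind: t => [|t c [u ut wst]]; first by exists [::]; rewrite ?cats0.
have [d wd] := treeAut_rcons w (s ++ t) c.
by exists (rcons u d); rewrite -?rcons_cat ?wd ?wst ?rcons_cat// !size_rcons ut.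
Qed.

(** Fixing one letter forces fixing both; the sections then arise by deleting the first letter of
    [w (c :: t)]. *)
Lemma fixes_letters_branch (w : treeAut) :
  w [:: false] = [:: false] -> exists x y, w = branch x y false.
Proof.
move=> wf.
have wt : w [:: true] = [:: true].
  have := size_treeAut w [:: true]; case e: (w [:: true]) => [|[] []]//= _.
  have [/bij_inj winj _ _] := treeAutP w.
  by have := winj _ _ (etrans wf (esym e)).
have wc c : w [:: c] = [:: c] by case: c.
have wcE c t : w (c :: t) = c :: behead (w (c :: t)).
  by have [u _] := treeAut_prefix w [:: c] t; rewrite wc => /= ->.
have sub c : is_tree_aut (fun t => behead (w (c :: t))).
  have [[v vw wv] _ we] := treeAutP w; split.
  (* The inverse of a section is the section of the inverse [v], once [v] is known to keep first
     letters. *)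
  - have vc t : v (c :: t) = c :: behead (v (c :: t)).
      have := wv (c :: t).
      case e: (v (c :: t)) => [|d u]; first by rewrite treeAut_nil.
      by rewrite wcE => -[-> _].
    exists (fun t => behead (v (c :: t))) => t.
    + by rewrite -wcE vw.
    + by rewrite -vc wv.
  - by rewrite wc.
  - move=> s t; have := we (c :: s) (c :: t).
    by rewrite (wcE c s) (wcE c t) !tree_edge_cons eqxx.
exists (TreeAut (asboolT (sub false))), (TreeAut (asboolT (sub true))).
apply: treeAut_eqP => -[|[] t]; first by rewrite !treeAut_nil.
  by rewrite branch_cons /= -wcE.
by rewrite branch_cons /= -wcE.
Qed.

(** If [w] exchanges the two letters, [sigma w] fixes them, and multiplying back by [sigma]
    exchanges the sections. *)
Lemma treeAut_branch (w : treeAut) : exists x y b, w = branch x y b.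
Proof.
have := size_treeAut w [:: false]; case e: (w [:: false]) => [|c []]//= _.
case: c e => e; last first.
  by have [x [y ->]] := fixes_letters_branch e; exists x, y, false.
have ss : branch 1 1 true = (branch 1 1 true)^-1%g by rewrite branchV invg1.
have [|x [y wE]] := @fixes_letters_branch (branch 1 1 true * w)%g.
  by rewrite treeAutM e branch_cons.
exists y, x, true; apply: (mulgI (branch 1 1 true)).
by rewrite wE branchM /= !mul1g.
Qed.

(** * Counting finite images through the sections at the root *)

Lemma mem_finset_image (T : Type) (A : finType) (Q : set T) (f : T -> A) p :
  (p \in [set p | p \in f @` Q]%SET) <-> exists2 u, Q u & f u = p.
Proof. by rewrite finset.in_set; split=> [/set_mem|] //; exact: mem_set. Qed.

(** On [Q] the value of [g] determines that of [f], so choosing for each value of [f] the [g]-value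
    of some preimage is injective; [h] makes this choice. *)
Lemma leq_card_image (T : Type) (A B : finType) (Q : set T) (f : T -> A)
    (g : T -> B) : (forall u v, Q u -> Q v -> g u = g v -> f u = f v) ->
  (#|[set p | p \in f @` Q]%SET| <= #|[set q | q \in g @` Q]%SET|)%N.
Proof.
move=> fg; pose h p := [pick q | `[< exists u, [/\ Q u, f u = p & g u = q] >]].
have hP u : Q u -> exists v, [/\ Q v, f v = f u & h (f u) = Some (g v)].
  move=> Qu; rewrite /h; case: pickP => [q /asboolP[v [Qv <- <-]]|/(_ (g u))].
    by exists v.
  by move/asboolPn; case; exists u.
rewrite -(card_in_imset (f := h)) => [|p p'].
  rewrite -[leqRHS](card_imset _ Some_inj).
  apply/subset_leq_card/fintype.subsetP => o.
  case/imsetP => p /mem_finset_image[u Qu <-] ->.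
  have [v [Qv _ ->]] := hP u Qu; apply/imset_f.
  by apply/mem_finset_image; exists v.
move=> /mem_finset_image[u Qu <-] /mem_finset_image[u' Qu' <-].
have [v [Qv <- ->]] := hP u Qu; have [v' [Qv' <- ->]] := hP u' Qu'.
by move=> [gv]; apply: fg.
Qed.

Lemma card_image_eq (T : Type) (A B : finType) (Q : set T) (f : T -> A)
    (g : T -> B) : (forall u v, Q u -> Q v -> g u = g v <-> f u = f v) ->
  #|[set p | p \in f @` Q]%SET| = #|[set q | q \in g @` Q]%SET|.
Proof.
by move=> fg; apply/eqP; rewrite eqn_leq !leq_card_image// => u v Qu Qv;
  move/(fg u v Qu Qv).
Qed.

Definition branch_restr n (u : treeAut * treeAut * bool) :=
  (restr n u.1.1, restr n u.1.2, u.2).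

(** By [agree_branch], restriction to level [n+1] and [branch_restr n] separate the same
    elements. *)
Lemma card_fin_image_branch n (Q : set (treeAut * treeAut * bool)) :
  #|fin_image n.+1 [set branch u.1.1 u.1.2 u.2 | u in Q]| =
  #|[set q | q \in branch_restr n @` Q]%SET|.
Proof.
rewrite /fin_image image_comp.
apply: card_image_eq => -[[x y] b] [[x' y'] b'] _ _ /=; split.
  rewrite /branch_restr /= => -[/restr_eqP xx' /restr_eqP yy' bb'].
  exact/restr_eqP/agree_branch.
move=> /restr_eqP/agree_branch[/restr_eqP xx' /restr_eqP yy' bb'].
by rewrite /branch_restr /= xx' yy' bb'.
Qed.

Lemma mem_fin_image n (G : set treeAut) p :
  (p \in fin_image n G) <-> exists2 g, G g & restr n g = p.
Proof. exact: mem_finset_image. Qed.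

Lemma restr0 w : restr 0 w = 1%g.
Proof.
rewrite -(restr1 0); apply/restr_eqP => -[|//] _.
by rewrite !treeAut_nil.
Qed.

Lemma card_fin_image0 (G : set treeAut) : G 1%g -> #|fin_image 0 G| = 1%N.
Proof.
move=> G1; apply/eqP/cards1P; exists 1%g; apply/setP => p; rewrite [RHS]inE.
apply/idP/eqP => [/mem_fin_image[g _ <-]|->]; first exact: restr0.
by apply/mem_fin_image; exists 1%g; rewrite ?restr0.
Qed.

Lemma card_fin_image_setTS n :
  #|fin_image n.+1 setT| = (2 * #|fin_image n setT| ^ 2)%N.
Proof.
transitivity #|fin_image n.+1 [set branch u.1.1 u.1.2 u.2 | u in setT]|.
  congr #|fin_image n.+1 (_ : set _)|; apply/seteqP; split=> // w _.
  by have [x [y [b ->]]] := treeAut_branch w; exists (x, y, b).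
rewrite card_fin_image_branch.
rewrite (_ : [set q | _]%SET =
  finset.setX (finset.setX (fin_image n setT) (fin_image n setT))
    [set: bool]%SET).
  by rewrite !cardsX cardsT card_bool mulnC mulnn.
apply/setP => -[[p q] b]; rewrite !finset.in_setX finset.in_setT andbT.
apply/idP/andP => [/mem_finset_image[[[x y] c] _ [<- <- _]]|].
  by split; apply/mem_fin_image; [exists x|exists y].
move=> [/mem_fin_image[x _ <-] /mem_fin_image[y _ <-]].
by apply/mem_finset_image; exists (x, y, b).
Qed.

Lemma card_fin_image_setT n : #|fin_image n setT| = (2 ^ (2 ^ n).-1)%N.
Proof.
elim: n => [|n IHn]; first by rewrite card_fin_image0.
rewrite card_fin_image_setTS IHn -expnM -expnS; congr expn.
by rewrite expnS; have := expn_gt0 2 n; lia.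
Qed.

(** * Extending automorphisms of [T_n] to [T], and the order of [W_n] *)

Lemma fin_tree_autV n (p : {perm n.-bseq bool}) :
  p \in fin_tree_aut n -> (p^-1)%g \in fin_tree_aut n.
Proof.
rewrite !finset.in_set => /andP[/eqP p0 /forallP pe]; apply/andP; split.
  by rewrite -{1}p0 permK.
apply/forallP => s; apply/forallP => t.
have /forallP/(_ ((p^-1)%g t))/eqP := pe ((p^-1)%g s).
by rewrite !permKV => ->.
Qed.

(* As [tree_edge] is preserved, [p] cannot increase the distance to the root,
   and neither can [p^-1]. *)
Lemma size_fin_tree_aut n (p : {perm n.-bseq bool}) (t : n.-bseq bool) :
  p \in fin_tree_aut n -> size (p t) = size t.
Proof.
have le (q : {perm n.-bseq bool}) (s : n.-bseq bool) :
    q \in fin_tree_aut n -> (size (q s) <= size s)%N.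
  rewrite finset.in_set => /andP[/eqP q0 /forallP qe]; case: s => s.
  elim/last_ind: s => [|s c IHs] sn.
    by rewrite [Bseq _](_ : _ = [bseq]) ?q0 //; exact/val_inj.
  have sn' : (size s <= n)%N by move: sn; rewrite size_rcons; exact: ltnW.
  have /forallP/(_ (Bseq sn))/eqP := qe (Bseq sn').
  rewrite tree_edge_rcons => /existsP[b].
  have := IHs sn'; rewrite /= size_rcons => le_s.
  case/orP => /eqP/(congr1 size); rewrite size_rcons => e; first by rewrite e.
  by apply: leqW; apply: leq_trans le_s; rewrite [leqRHS]e leqnSn.
move=> pn; apply/eqP; rewrite eqn_leq le//=.
rewrite -{1}[t](permK p); apply: le.
exact: fin_tree_autV.
Qed.


Lemma size_take_bseq n (t : seq bool) : (size (take n t) <= n)%N.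
Proof. by rewrite size_take_min geq_minl. Qed.

(** A lift of [p] along [restr n], acting trivially below level [n]. *)
Definition extend_fun n (p : {perm n.-bseq bool}) (t : seq bool) : seq bool :=
  p (Bseq (size_take_bseq n t)) ++ drop n t.

Lemma extend_fun_small n (p : {perm n.-bseq bool}) t (tn : (size t <= n)%N) :
  extend_fun p t = p (Bseq tn).
Proof.
rewrite /extend_fun drop_oversize// cats0; congr (val (p _)).
by apply/val_inj; rewrite /= take_oversize.
Qed.

Lemma extend_fun_cat n (p : {perm n.-bseq bool}) (s : n.-bseq bool) t :
  size s = n -> extend_fun p (s ++ t) = p s ++ t.
Proof.
move=> sn; rewrite /extend_fun drop_size_cat//; congr (val (p _) ++ _).
by apply/val_inj; rewrite /= take_size_cat.
Qed.

Lemma extend_fun_edge n (p : {perm n.-bseq bool}) s b :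
  p \in fin_tree_aut n ->
  tree_edge (extend_fun p s) (extend_fun p (rcons s b)).
Proof.
move=> pn; have [sn|ns] := ltnP (size s) n.
  have sn' : (size (rcons s b) <= n)%N by rewrite size_rcons.
  rewrite (extend_fun_small p (ltnW sn)) (extend_fun_small p sn').
  move: pn; rewrite finset.in_set => /andP[_ /forallP/(_ (Bseq (ltnW sn)))].
  by move=> /forallP/(_ (Bseq sn'))/eqP->; rewrite tree_edge_rcons.
have tn : size (Bseq (size_take_bseq n s)) = n.
  by rewrite /= size_take_min; apply/minn_idPl.
rewrite [s](_ : _ = Bseq (size_take_bseq n s) ++ drop n s); last first.
  by rewrite /= cat_take_drop.
rewrite rcons_cat !extend_fun_cat//.
by rewrite -rcons_cat tree_edge_rcons.
Qed.

Lemma extend_funK n (p : {perm n.-bseq bool}) : p \in fin_tree_aut n ->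
  cancel (extend_fun p) (extend_fun (p^-1)%g).
Proof.
move=> pn t; have [tn|nt] := leqP (size t) n.
  rewrite (extend_fun_small p tn).
  rewrite (extend_fun_small _ (size_bseq (p (Bseq tn)))).
  by rewrite (_ : Bseq _ = p (Bseq tn)) ?permK//; exact/val_inj.
have tn : size (Bseq (size_take_bseq n t)) = n.
  by rewrite /= size_take_min; apply/minn_idPl/ltnW.
rewrite [t](_ : _ = Bseq (size_take_bseq n t) ++ drop n t); last first.
  by rewrite /= cat_take_drop.
(* As [p] preserves length, its value again has length [n], so [extend_fun_cat] applies a second
   time. *)
by rewrite extend_fun_cat// extend_fun_cat ?permK// size_fin_tree_aut.
Qed.

Lemma is_tree_aut_extend n (p : {perm n.-bseq bool}) :
  p \in fin_tree_aut n -> is_tree_aut (extend_fun p).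
Proof.
have edge (q : {perm n.-bseq bool}) s t : q \in fin_tree_aut n ->
    tree_edge s t -> tree_edge (extend_fun q s) (extend_fun q t).
  move=> qn /existsP[b /orP[]/eqP->]; first exact: extend_fun_edge.
  by rewrite tree_edgeC; exact: extend_fun_edge.
move=> pn; have pVn := fin_tree_autV pn; split.
- exists (extend_fun (p^-1)%g); first exact: extend_funK.
  by have := extend_funK pVn; rewrite invgK.
- move: pn; rewrite finset.in_set => /andP[/eqP p0 _].
  rewrite (@extend_fun_small n p [::] (leq0n n)).
  by rewrite [Bseq _](_ : _ = [bseq]) ?p0//; exact/val_inj.
- move=> s t; apply/idP/idP => [/(edge _ _ _ pVn)|]; last exact: edge.
  by rewrite !extend_funK.
Qed.

(** Every automorphism of [T_n] extends to [T], so [W_n] can be counted through [W], where the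
    recursion at the root is available. *)
Lemma fin_tree_autE n : fin_tree_aut n = fin_image n setT.
Proof.
apply/setP => p; apply/idP/idP => [pn|/mem_fin_image[w _ <-]].
  apply/mem_fin_image.
  exists (TreeAut (asboolT (is_tree_aut_extend pn))) => //.
  apply/permP => t; rewrite !permE; apply/val_inj => /=.
  rewrite (extend_fun_small p (size_bseq t)); congr (val (p _)).
  exact/val_inj.
exact: restr_fin_tree_aut.
Qed.

Lemma card_fin_tree_aut n : #|fin_tree_aut n| = (2 ^ (2 ^ n).-1)%N.
Proof. by rewrite fin_tree_autE card_fin_image_setT. Qed.

(** * Exponent sums of words in the generators *)

Definition zpow (g : treeAut) (k : int) : treeAut :=
  match k with Posz n => g ^+ n | Negz n => g ^- n.+1 end%g.

Lemma zpowS g k : zpow g (k + 1)%R = (g * zpow g k)%g.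
Proof.
case: k => n; first by rewrite -PoszD addn1 /= expgS.
have -> : (Negz n + 1)%R = (- n%:Z)%R by lia.
rewrite /= expgSr invgM mulKVg; case: n => [|n]; first by rewrite /= invg1.
by rewrite -NegzE.
Qed.

Lemma zpowD g j k : zpow g (j + k)%R = (zpow g j * zpow g k)%g.
Proof.
have zpowB i : zpow g (i - 1)%R = (g^-1 * zpow g i)%g.
  by apply: (mulgI g); rewrite mulVKg -zpowS; congr zpow; lia.
elim/int_rect: j => [|j IHj|j IHj]; first by rewrite add0r mul1g.
  have -> : (j.+1%:Z + k = j%:Z + k + 1)%R by lia.
  have -> : (j.+1%:Z = j%:Z + 1)%R by lia.
  by rewrite !zpowS IHj mulgA.
have -> : (- j.+1%:Z + k = - j%:Z + k - 1)%R by lia.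
have -> : (- j.+1%:Z = - j%:Z - 1)%R by lia.
by rewrite !zpowB IHj mulgA.
Qed.

Lemma zpowN g k : zpow g (- k)%R = (zpow g k)^-1%g.
Proof. by apply: (mulgI (zpow g k)); rewrite -zpowD mulgV subrr. Qed.

Lemma branchX x y m : (branch x y false ^+ m)%g = branch (x ^+ m) (y ^+ m) false.
Proof.
by elim: m => [|m IHm]; [rewrite branch1|rewrite !expgS IHm branchM].
Qed.

Lemma branch_zpow x y k :
  branch (zpow x k) (zpow y k) false = zpow (branch x y false) k.
Proof. by case: k => n; rewrite /= branchX // branchV. Qed.

Lemma agree_mul n v w v' w' : agree n v v' -> agree n w w' ->
  agree n (v * w)%g (v' * w')%g.
Proof. by move=> vv ww t tn; rewrite !treeAutM ww// vv// size_treeAut. Qed.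

Lemma agree_zpow n h k : agree n h 1%g -> agree n (zpow h k) 1%g.
Proof.
move=> h1; have powP m : agree n (h ^+ m)%g 1%g.
  elim: m => [|m IHm] //.
  by rewrite expgS -[X in agree _ _ X]mulg1; exact: agree_mul.
(* For a negative exponent, injectivity of [h ^+ m.+1] reduces the claim to positive powers. *)
case: k => m //= t tn; have [/bij_inj inj _ _] := treeAutP (h ^+ m.+1)%g.
by apply: inj; rewrite -treeAutM mulgV [RHS]powP.
Qed.

Section Generators.

Variables (r : nat) (a : nat -> treeAut).
Hypothesis r_ge1 : (1 <= r)%N.
Hypothesis a_1 : a 1%N = (tree_pair (a r) 1 * sigma)%g.
Hypothesis a_i :
  forall i : nat, (2 <= i <= r)%N -> a i = tree_pair (a i.-1) 1%g.

(* [word g e]: some word in the generators has value [g] and exponent sum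
   [e i] in [a i]. *)
Inductive word : treeAut -> (nat -> int) -> Prop :=
| word1 : word 1%g (fun=> 0%R)
| word_gen i : (1 <= i <= r)%N -> word (a i) (fun j => (j == i)%:Z)%R
| wordM g e h f : word g e -> word h f -> word (g * h)%g (fun j => e j + f j)%R
| wordV g e : word g e -> word g^-1%g (fun j => - e j)%R.

Definition spelled : set treeAut := [set g | exists e, word g e].

Lemma spelled1 : spelled 1%g.
Proof. by eexists; exact: word1. Qed.

Lemma spelledM g h : spelled g -> spelled h -> spelled (g * h)%g.
Proof. by move=> [e ge] [f hf]; eexists; exact: wordM ge hf. Qed.

Lemma spelledV g : spelled g -> spelled g^-1%g.
Proof. by move=> [e ge]; eexists; exact: wordV ge. Qed.

Lemma spelled_gen i : (1 <= i <= r)%N -> spelled (a i).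
Proof. by move=> ir; eexists; exact: word_gen ir. Qed.

Lemma a_1E : a 1 = branch (a r) 1 true. Proof. exact: a_1. Qed.

Lemma a_iE i : (2 <= i <= r)%N -> a i = branch (a i.-1) 1 false.
Proof. by move=> ir; rewrite /branch mulg1 a_i. Qed.

(** Induction on the word. A left factor with [b = true] exchanges the sections of the right factor,
    and with them their exponent functions. *)
Lemma word_branch g e : word g e -> exists x y b e' f,
  [/\ g = branch x y b, word x e' & word y f] /\
  [/\ e' r = f r + b%:Z, e 1%N = e' r + f r &
    forall i, (2 <= i <= r)%N -> e i = e' i.-1 + f i.-1]%R.
Proof.
elim=> {g e} [|i ir|g e h f _ IHg _ IHh|g e _ IHg].
- exists 1%g, 1%g, false, (fun=> 0%R), (fun=> 0%R).
  by rewrite branch1; do !split; exact: word1.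
- case: (ltngtP 1 i) => [i1|i0|<-]; last 2 first.
  + by move: ir; rewrite leqNgt i0.
  + exists (a r), 1%g, true; do 2!eexists; split.
      split; [exact: a_1E| |exact: word1].
      by apply: word_gen; rewrite r_ge1 leqnn.
    rewrite /= !eqxx; split=> // -[|[|j]]// jr.
    by rewrite (ltn_eqF (_ : j.+1 < r)%N).
  have ir' : (2 <= i <= r)%N by case/andP: ir => _ ->; rewrite i1.
  exists (a i.-1), 1%g, false; do 2!eexists; split.
    by split; [exact: a_iE|apply: word_gen; lia|exact: word1].
  rewrite /=; split; [|lia|by case: (i) i1 => // k _ [|j] // _; rewrite addr0].
  by lia.
- have [x [y [b [e1 [f1 [[-> xe1 yf1] [eq1 eq2 eq3]]]]]]] := IHg.
  have [x' [y' [b' [e2 [f2 [[-> xe2 yf2] [eq1' eq2' eq3']]]]]]] := IHh.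
  exists (x * if b then y' else x')%g, (y * if b then x' else y')%g, (b (+) b').
  exists (fun j => e1 j + if b then f2 j else e2 j)%R.
  exists (fun j => f1 j + if b then e2 j else f2 j)%R.
  split; first by rewrite branchM; case: (b); split=> //; exact: wordM.
  split; [|by case: (b); rewrite eq2 eq2'; ring|].
    (* The exchange negates the difference contributed by the right factor, so for [b = b' = true]
       the two contributions cancel. *)
    by case: b b' eq1 eq1' => [] []; rewrite /=; lia.
  by move=> i ir; rewrite eq3 // eq3' //; case: (b); ring.
- have [x [y [b [e1 [f1 [[-> xe1 yf1] [eq1 eq2 eq3]]]]]]] := IHg.
  exists (if b then y else x)^-1%g, (if b then x else y)^-1%g, b.
  exists (fun j => - if b then f1 j else e1 j)%R.
  exists (fun j => - if b then e1 j else f1 j)%R.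
  split; first by rewrite branchV; case: (b); split=> //; exact: wordV.
  split; [|by case: (b); rewrite eq2; ring|].
    by case: b eq1 => /=; lia.
  by move=> i ir; rewrite eq3 //; case: (b); ring.
Qed.

Lemma zpow_spelled g k : spelled g -> spelled (zpow g k).
Proof.
have powS n h : spelled h -> spelled (h ^+ n)%g.
  move=> hs; elim: n => [|n IHn]; first exact: spelled1.
  by rewrite expgS; exact: spelledM.
by move=> gs; case: k => n; [exact: powS|exact/spelledV/powS].
Qed.

Lemma sq_a_1 : (a 1 * a 1)%g = branch (a r) (a r) false.
Proof. by rewrite a_1E branchM mulg1 mul1g. Qed.

(* This relies on [(a r, a r) = a 1 * a 1], and on [(a i, 1)] and its conjugate
   [(1, a i)] by [a 1] being spelled for [i < r]. *)
Lemma word_branch_zpow x e : word x e ->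
  spelled (branch x (zpow (a r) (e r)) false) /\
  spelled (branch (zpow (a r) (e r)) x false).
Proof.
have s1 : spelled (a 1) by apply: spelled_gen; rewrite leqnn.
have srr : spelled (branch (a r) (a r) false) by rewrite -sq_a_1; exact: spelledM.
elim=> {x e} [|i ir|g e h f _ [IHg IHg'] _ [IHh IHh']|g e _ [IHg IHg']].
- by rewrite /= branch1; split; exact: spelled1.
- have [->|ni] := eqVneq i r; first by [].

  have sl : spelled (branch (a i) 1 false).
    by rewrite -[i]/i.+1.-1 -a_iE; [apply: spelled_gen|]; lia.
  split=> //=; have := spelledM (spelledM s1 sl) (spelledV s1).
  by rewrite a_1E branchV !branchM /= ?(mulg1, mul1g, invg1) mulgV.
- rewrite zpowD; split; [have := spelledM IHg IHh|have := spelledM IHg' IHh'];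
    by rewrite branchM.
- by rewrite zpowN; split; [have := spelledV IHg|have := spelledV IHg'];
    rewrite branchV.
Qed.

Lemma word_a_r : word (a r) (fun j => (j == r)%:Z)%R.
Proof. by apply: word_gen; rewrite r_ge1 leqnn. Qed.

(** Converse to [word_branch]: the relation between the exponents of [a r] is the only constraint on
    the sections. *)
Lemma branch_word x y (b : bool) e f :
  word x e -> word y f -> e r = (f r + b%:Z)%R -> spelled (branch x y b).
Proof.
have s1 : spelled (a 1) by apply: spelled_gen; rewrite leqnn.
have srr k : spelled (branch (zpow (a r) k) (zpow (a r) k) false).
  rewrite branch_zpow -sq_a_1.
  by apply/zpow_spelled/spelledM.
have s0 x' y' e' f' : word x' e' -> word y' f' -> e' r = f' r ->
    spelled (branch x' y' false).
  (* [(x, y) = (x, c) (c, c)^-1 (c, y)] with [c] a power of [a r]. *)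
  move=> /word_branch_zpow[xe _] /word_branch_zpow[_ yf] ef.
  have := spelledM (spelledM xe (spelledV (srr (e' r)))) yf.
  by rewrite branchV !branchM /= ef mulgVK mulgV mul1g.
case: b => xe yf /=; last by rewrite addr0 => ef; exact: s0 xe yf ef.
move=> ef.
(* Since [(x, y) sigma = (x (a r)^-1, y) (a 1)], the case without exchange suffices. *)
have := spelledM (s0 _ _ _ _ (wordM xe (wordV word_a_r)) yf _) s1.
rewrite a_1E branchM /= mulgVK mulg1; apply.
by rewrite eqxx ef; lia.
Qed.

(* The order of [a i] on words of length at most [n]. *)
Definition level_exp n i := (2 ^ ((n + (r - i)) %/ r))%N.

(** For [i > 1], [e_i] is a sum of exponents [e_(i-1)] of the sections, with the same bound one
    level lower. For [i = 1], triviality at the root makes both [e_r] equal, and [e_1 = 2 e_r]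
    supplies the extra factor 2. *)
Lemma word_exp_dvd n g e i : word g e -> agree n g 1%g -> (1 <= i <= r)%N ->
  (level_exp n i %| e i)%Z.
Proof.
elim: n g e i => [|n IHn] g e i.
  move=> _ _ ir; rewrite /level_exp add0n divn_small ?dvd1z//; lia.
move=> /word_branch[x [y [b [e' [f [[-> xe yf] [eq1 eq2 eq3]]]]]]].
rewrite -branch1 => /agree_branch[x1 y1 b0] ir; rewrite b0 addr0 in eq1.
case: (ltngtP 1 i) => [i1|i0|<-]; last 2 first.
- by move: ir; rewrite leqNgt i0.
- have /(_ r) := IHn _ _ _ xe x1.
  rewrite eq2 -eq1 /level_exp r_ge1 leqnn subnn addn0.
  rewrite (_ : n.+1 + (r - 1) = n + r)%N; last by lia.
  rewrite divnDr ?dvdnn// divnn r_ge1 addn1 expnS PoszM => /(_ isT) d.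
  by rewrite -mulr2n -mulr_natl dvdz_mul.
rewrite eq3; last by case/andP: ir => _ ->; rewrite i1.
rewrite /level_exp (_ : n.+1 + (r - i) = n + (r - i.-1))%N; last by lia.
by apply: rpredD; [apply: IHn xe x1 _|apply: IHn yf y1 _]; lia.
Qed.

(** The same recursion for powers: [a i ^ m = (a (i-1) ^ m, 1)] for [i > 1], and
    [a 1 ^ (2 m) = (a r ^ m, a r ^ m)]. *)
Lemma agree_expg n i : (1 <= i <= r)%N -> agree n (a i ^+ level_exp n i)%g 1%g.
Proof.
elim: n i => [|n IHn] i ir.
  by move=> [|//] _; rewrite !treeAut_nil.
case: (ltngtP 1 i) => [i1|i0|<-]; last 2 first.
- by move: ir; rewrite leqNgt i0.
- rewrite /level_exp (_ : n.+1 + (r - 1) = n + r)%N; last by lia.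
  rewrite divnDr ?dvdnn// divnn r_ge1 addn1 expnS expgM expgS expg1 sq_a_1.
  have := IHn r; rewrite r_ge1 leqnn /level_exp subnn addn0 => /(_ isT) h.
  by rewrite branchX -branch1; apply/agree_branch.
rewrite a_iE; last by case/andP: ir => _ ->; rewrite i1.
rewrite branchX expg1n -[X in agree _ _ X]branch1; apply/agree_branch; split=> //.
rewrite /level_exp (_ : n.+1 + (r - i) = n + (r - i.-1))%N; last by lia.
by apply: IHn; lia.
Qed.


Lemma word_zpow g e k : word g e -> word (zpow g k) (fun j => k * e j)%R.
Proof.
move=> ge; have powP n : word (g ^+ n)%g (fun j => n%:Z * e j)%R.
  elim: n => [|n IHn].
    rewrite (_ : (fun _ => _) = fun=> 0%R); first exact: word1.
    by apply/funext => j; rewrite mul0r.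
  rewrite expgS (_ : (fun _ => _) = fun j => e j + n%:Z * e j)%R.
    exact: wordM.
  by apply/funext => j; rewrite intS; ring.
case: k => n /=; first exact: powP.
rewrite (_ : (fun _ => _) = fun j => - (n.+1%:Z * e j))%R.
  exact/wordV/powP.
by apply/funext => j; rewrite NegzE mulNr.
Qed.

(** * Classes of the exponent [e_r] modulo the order of [a r] on [T_n] *)

Definition exp_class n (k : int) :=
  fin_image n [set g | exists e, word g e /\ e r = k].

Definition modulus n := level_exp n r.

Lemma modulusE n : modulus n = (2 ^ (n %/ r))%N.
Proof. by rewrite /modulus /level_exp subnn addn0. Qed.

(** Multiplying by a power of [a r ^+ modulus n] shifts the exponent without changing the
    restriction. *)
Lemma sub_exp_class n (k k' : int) p :
  (modulus n %| (k' - k)%R)%Z -> p \in exp_class n k -> p \in exp_class n k'.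
Proof.
move=> /dvdzP[q kk'] /mem_fin_image[g [e [ge er]] <-].
pose h := zpow (a r ^+ modulus n)%g q.
have h1 : agree n h 1%g by apply/agree_zpow/agree_expg; rewrite r_ge1 leqnn.
have hw := word_zpow q (word_zpow (modulus n) word_a_r).
apply/mem_fin_image; exists (g * h)%g.
  eexists; split; first exact: wordM ge hw.
  by rewrite /= eqxx er mulr1 -kk'; ring.
by rewrite restrM (_ : restr n h = 1%g) ?mul1g// -(restr1 n); apply/restr_eqP.
Qed.

(** The quotient of two words with the same restriction is trivial on [T_n], so [word_exp_dvd]
    applies. *)
Lemma exp_class_dvd n (k k' : int) p :
  p \in exp_class n k -> p \in exp_class n k' -> (modulus n %| (k - k')%R)%Z.
Proof.
move=> /mem_fin_image[g [e [ge <-]] <-] /mem_fin_image[g' [e' [ge' <-]] gg'].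
have d := wordM ge (wordV ge').
apply: (word_exp_dvd (i := r) d); last by rewrite r_ge1 leqnn.
apply/restr_eqP; rewrite restrM restr1.
have -> : restr n g'^-1%g = ((restr n g')^-1)%g.
  by apply: (mulIg (restr n g')); rewrite mulVg -restrM mulgV restr1.
by rewrite gg' mulVg.
Qed.

(** Right multiplication by [a r ^ (k' - k)] carries one class into the other; it becomes a left
    coset because [restrM] reverses products. *)
Lemma leq_card_exp_class n (k k' : int) :
  (#|exp_class n k| <= #|exp_class n k'|)%N.
Proof.
pose h := zpow (a r) (k' - k)%R.
rewrite -(card_lcoset _ (restr n h)); apply/subset_leq_card/fintype.subsetP => p.
case/lcosetP => _ /mem_fin_image[g [e [ge er]] <-] ->.
apply/mem_fin_image; exists (g * h)%g; last by rewrite restrM.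
eexists; split; first exact: wordM ge (word_zpow (k' - k)%R word_a_r).
by rewrite /= eqxx er mulr1 addrC subrK.
Qed.

Lemma card_exp_class n (k : int) : #|exp_class n k| = #|exp_class n 0|.
Proof. by apply/eqP; rewrite eqn_leq !leq_card_exp_class. Qed.

Lemma disjoint_exp_class n (i j : 'I_(modulus n)) (k : int) : i != j ->
  [disjoint exp_class n (i%:Z + k)%R & exp_class n (j%:Z + k)%R]%B.
Proof.
move=> ij; apply/pred0P => p; apply/negP => /andP[pi pj].
case/negP: ij; have := exp_class_dvd pi pj; rewrite opprD addrACA subrr addr0.
move=> /dvdzP[q ijq]; apply/eqP/val_inj.
have [i_lt j_lt] := (ltn_ord i, ltn_ord j).
have : q = 0 by move: ijq i_lt j_lt; nia.
by move=> q0; move: ijq; rewrite q0 mul0r => /eqP; rewrite subr_eq0 => /eqP[].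
Qed.

Lemma modulus_gt0 n : (0 < modulus n)%N.
Proof. by rewrite expn_gt0. Qed.

(** The shift [l] lets one representative [i] serve both sections, whose exponents differ by [b]. *)
Lemma exp_class_ord n (k : int) : exists i : 'I_(modulus n),
  forall l, exp_class n (i%:Z + l)%R = exp_class n (k + l)%R.
Proof.
have M0 : ((modulus n)%:Z != 0)%R by rewrite eqz_nat -lt0n modulus_gt0.
have km : (`|(k %% modulus n)%Z|%N < modulus n)%N.
  by have := ltz_mod k M0; have := modz_ge0 k M0; lia.
exists (Ordinal km) => l; rewrite /= gez0_abs ?modz_ge0//.
have d : (modulus n %| (k - (k %% modulus n)%Z)%R)%Z.
  by rewrite {1}(divz_eq k (modulus n)) addrK dvdz_mull.
apply/setP => p; apply/idP/idP; apply: sub_exp_class;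
  rewrite opprD addrACA subrr addr0 //.
by rewrite -opprB rpredN.
Qed.

Lemma card_fin_image_spelled n :
  #|fin_image n spelled| = (modulus n * #|exp_class n 0|)%N.
Proof.
have -> : fin_image n spelled =
    (\bigcup_(i < modulus n) exp_class n (i%:Z + 0)%R)%SET.
  apply/setP => p; apply/idP/finset.bigcupP => [|[i _]].
    move=> /mem_fin_image[g [e ge] <-]; have [i iE] := exp_class_ord n (e r).
    exists i => //; rewrite iE addr0; apply/mem_fin_image; exists g => //.
    by exists e.
  move=> /mem_fin_image[g [e [ge _]] <-]; apply/mem_fin_image; exists g => //.
  by exists e.
rewrite -sum1_card partition_disjoint_bigcup; last first.
  by move=> i j ij; exact: disjoint_exp_class.
under eq_bigr do rewrite sum1_card card_exp_class.
by rewrite sum_nat_const card_ord.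
Qed.

Lemma card_fin_image_spelledS n :
  #|fin_image n.+1 spelled| = (2 * modulus n * #|exp_class n 0| ^ 2)%N.
Proof.
pose Q := [set u : treeAut * treeAut * bool | exists e f,
  [/\ word u.1.1 e, word u.1.2 f & e r = f r + u.2%:Z]%R].
transitivity #|fin_image n.+1 [set branch u.1.1 u.1.2 u.2 | u in Q]|.
  congr #|fin_image n.+1 (_ : set _)|; apply/seteqP; split=> w.
    move=> [e /word_branch[x [y [b [e' [f [[-> xe yf] [ef _ _]]]]]]]].
    by exists (x, y, b) => //; exists e', f.
  by move=> [[[x y] b] /= [e [f [xe yf ef]]] <-]; exact: branch_word xe yf ef.
rewrite card_fin_image_branch.
(* [F] sorts the triples by the class [i] of [y] and by [b]; then [x] ranges over the class of
   [i + b]. *)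
pose F (i : 'I_(modulus n) * bool) := finset.setX
  (finset.setX (exp_class n (i.1%:Z + i.2%:Z)%R) (exp_class n (i.1%:Z + 0)%R))
  [set i.2]%SET.
have -> : [set q | q \in branch_restr n @` Q]%SET = (\bigcup_i F i)%SET.
  apply/setP => -[[p q] b]; apply/idP/finset.bigcupP => [|[[i c] _]].
    move=> /mem_finset_image[[[x y] c] [e [f /= [xe yf ef]]] [<- <- <-]].
    have [i iE] := exp_class_ord n (f r).
    exists (i, c) => //.
    rewrite !finset.in_setX finset.in_set1 eqxx andbT /= !iE addr0 -ef.
    apply/andP; split; apply/mem_fin_image; first by exists x => //; exists e.
    by exists y => //; exists f.
  rewrite !finset.in_setX finset.in_set1 /= => /andP[/andP[]].
  move=> /mem_fin_image[x [e [xe er]] <-].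
  move=> /mem_fin_image[y [f [yf fr]] <-] /eqP->.
  apply/mem_finset_image; exists (x, y, c) => //; exists e, f; split=> //=.
  by rewrite er fr addr0.
rewrite -sum1_card partition_disjoint_bigcup => [|[i b] [j c] ij].
  under eq_bigr do
    rewrite sum1_card !cardsX cards1 !card_exp_class muln1 mulnn.
  by rewrite sum_nat_const card_prod card_ord card_bool [(_ * 2)%N]mulnC.
(* A common triple determines [b] by its last entry and [i] by the class of its second entry. *)
apply/pred0P => -[[p q] d]; apply/negP => /=.
rewrite /F !finset.in_setX !finset.in_set1 /=.
move=> /andP[/andP[/andP[_ qi] /eqP db] /andP[/andP[_ qj] /eqP dc]].
have ij' : i != j by apply: contraNneq ij => ->; rewrite -db -dc.
by have /pred0P/(_ q) := disjoint_exp_class 0 ij'; rewrite /= qi qj.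
Qed.

Lemma card_fin_image_rec n :
  (#|fin_image n.+1 spelled| * 2 ^ (n %/ r) = 2 * #|fin_image n spelled| ^ 2)%N.
Proof.
by rewrite card_fin_image_spelledS card_fin_image_spelled -modulusE; ring.
Qed.

End Generators.

(** * Generation, closure and the limit *)

Lemma generated_subgroupE r (a : nat -> treeAut) :
  generated_subgroup [set a i | i in [set i : nat | (1 <= i <= r)%N]] =
  spelled r a.
Proof.
apply/seteqP; split.
  apply: smallest_sub => [|_ [i ir <-]]; last exact: spelled_gen.
  split; first exact/mem_set/spelled1.
  move=> g h /set_mem gs /set_mem hs; apply/mem_set.
  exact/spelledM/spelledV.
move=> g [e ge] H [Hgrp aH]; have [H1 _] := Hgrp.
have HM := group_closedM Hgrp; have HV := group_closedV Hgrp.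
elim: ge => {g e} [|i ir|g e h f _ Hg _ Hh|g e _ Hg].
- exact/set_mem.
- by apply: aH; exists i.
- by apply/set_mem/HM; exact/mem_set.
- by apply/set_mem/HV; exact/mem_set.
Qed.

Lemma continuous_restr n :
  continuous (restr n : treeAut -> discrete_topology {perm n.-bseq bool}).
Proof.
move=> w; apply: (@continuous_comp _ _ _ restr_all (proj n)).
  exact: initial_continuous.
exact: proj_continuous.
Qed.

(** Prescribing the restriction to [T_n] is an open condition, so each point of the closure
    restricts like some point of [A]. Hence [G_n] is already the image of the discrete group. *)
Lemma fin_image_closure n (A : set treeAut) :
  fin_image n (closure A) = fin_image n A.
Proof.
apply/setP => p; apply/idP/idP => /mem_fin_image[w Aw <-]; apply/mem_fin_image.
  have [|v [Av /= vw]] := Aw (restr n @^-1` [set restr n w]); last by exists v.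
  apply: (@continuous_restr n w).
  apply: open_nbhs_nbhs; split=> //.
  exact: (@discrete_open (discrete_topology {perm n.-bseq bool})).
by exists w => //; exact: subset_closure.
Qed.

(** * The closed form of [log2 |G_n|] and its limit *)

Section Dimension.

Variable R : realType.
Local Open Scope ring_scope.

Lemma ln2_neq0 : ln (2 : R) != 0.
Proof. by rewrite gt_eqF// ln_gt0// ltr1n. Qed.

Lemma log2M (x y : R) : 0 < x -> 0 < y -> log2 (x * y) = log2 x + log2 y.
Proof. by move=> x0 y0; rewrite /log2 lnM ?posrE// mulrDl. Qed.

Lemma log2_pow2 k : log2 ((2 ^ k)%N%:R : R) = k%:R.
Proof.
rewrite /log2 natrX lnXn// -[X in X / _]mulr_natr mulrAC mulfV ?mul1r//.
exact: ln2_neq0.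
Qed.

(** In logarithms the recursion is linear, [L(n+1) = 1 + 2 L(n) - floor(n/r)]; the induction step
    splits on whether [r] divides [n+1]. *)
Lemma log2_closed_form (r : nat) (N : nat -> nat) (n : nat) : (1 <= r)%N ->
  N 0%N = 1%N -> (forall n, (N n.+1 * 2 ^ (n %/ r) = 2 * N n ^ 2)%N) ->
  log2 ((N n)%:R : R) = (1 - (2 ^+ r - 1)^-1) * (2 ^+ n - 1) +
    ((n %/ r)%:R + (2 ^+ (n %% r) - 1) / (2 ^+ r - 1)).
Proof.
move=> r_ge1 N0 Nrec.
have Npos m : (0 < N m)%N.
  elim: m => [|m IHm]; first by rewrite N0.
  have := Nrec m; case: (N m.+1) => // /esym/eqP; rewrite mul0n.
  by rewrite muln_eq0 expn_eq0 /= andbT => /eqP Nm; rewrite Nm in IHm.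
have D0 : 2 ^+ r - 1 != 0 :> R.
  by rewrite subr_eq0 gt_eqF// exprn_egt1 ?ltr1n// -lt0n.
elim: n => [|n IHn].
  by rewrite N0 (log2_pow2 0) div0n mod0n !expr0 !subrr mulr0 mul0r !addr0.
have step :
    log2 ((N n.+1)%:R : R) = 1 + 2 * log2 ((N n)%:R : R) - (n %/ r)%:R.
  have := congr1 (fun k : nat => log2 (k%:R : R)) (Nrec n).
  rewrite -mulnn !natrM !log2M ?mulr_gt0 ?ltr0n ?expn_gt0 ?Npos//.
  by rewrite log2_pow2 (log2_pow2 1) => h; lra.
(* If [r] divides [n+1], the quotient grows by one and the remainder drops from [r - 1] to 0;
   otherwise only the remainder grows. *)
have [nr|nr] := eqVneq (n %% r).+1 r.
  have nE : n.+1 = ((n %/ r).+1 * r)%N.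
    by rewrite [in LHS](divn_eq n r) -addnS nr mulSn addnC.
  have -> : (n.+1 %/ r = (n %/ r).+1)%N by rewrite nE mulnK.
  have -> : (n.+1 %% r = 0)%N by rewrite nE modnMl.
  rewrite step IHn -[(n %/ r).+1]addn1 natrD expr0 exprS.
  have -> : 2 ^+ (n %% r) = 2 ^+ r / 2 :> R.
    by rewrite -[X in 2 ^+ X / _]nr exprS mulrC mulKf// pnatr_eq0.
  by field.
have lt : ((n %% r).+1 < r)%N by rewrite ltn_neqAle nr ltn_pmod.
have -> : (n.+1 %/ r = n %/ r)%N.
  by rewrite {1}(divn_eq n r) -addnS divnMDl// (divn_small lt) addn0.
have -> : (n.+1 %% r = (n %% r).+1)%N.
  by rewrite {1}(divn_eq n r) -addnS modnMDl modn_small.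
by rewrite step IHn !exprS; field.
Qed.

Lemma cvg_linear_over_pow2 :
  (fun n : nat => n.+1%:R / (2 ^+ n - 1) : R) @ \oo --> (0 : R).
Proof.
(* This amounts to [(n+2) / (2^(n+1) - 1) <= 4 / (n+2)], whose right side is [4 * harmonic n.+1]. *)
have bound n : (n.+2 ^ 2 + 4 <= 4 * 2 ^ n.+1)%N.
  by elim: n => // n; rewrite (expnS 2 n.+1) -!mulnn; lia.
apply: (@squeeze_cvgr _ _ _ _ (fun=> 0) (fun n => 4 * harmonic n)).
- apply: nearW => -[|n].
  (* At [n = 0] the denominator vanishes and the quotient is 0 by convention. *)
  by rewrite expr0 subrr invr0 mulr0 lexx /= mulr_ge0 ?harmonic_ge0.
  have p0 : 0 < 2 ^+ n.+1 - 1 :> R by rewrite subr_gt0 exprn_egt1 ?ltr1n.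
  rewrite divr_ge0 ?(ltW p0)//= ler_pdivrMr// /harmonic mulrAC ler_pdivlMr//.
  have := bound n; rewrite -(ler_nat R) natrD natrM !natrX => h.
  by lra.
- exact: cvg_cst.
- by rewrite -[X in _ --> X](mulr0 4); apply: cvgMr; exact: cvg_harmonic.
Qed.

End Dimension.

Theorem theorem2p3p2 (R : realType) (r : nat) (a : nat -> treeAut)
    (r_ge1 : (1 <= r)%N)
    (a_1 : a 1%N = (tree_pair (a r) 1 * sigma)%g)
    (a_i : forall i : nat, (2 <= i <= r)%N -> a i = tree_pair (a i.-1) 1%g) :
  has_hausdorff_dim
    (topologically_generated [set a i | i in [set i : nat | (1 <= i <= r)%N]]%classic)
    (1 - (2 ^+ r - 1)^-1 : R)%R.
Proof.
rewrite /has_hausdorff_dim /topologically_generated generated_subgroupE.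
set D := (1 - _)%R.
have logN n := log2_closed_form R n r_ge1 (card_fin_image0 (spelled1 r a))
  (card_fin_image_rec r_ge1 a_1 a_i).
have D0 : (0 < 2 ^+ r - 1 :> R)%R by rewrite subr_gt0 exprn_egt1 ?ltr1n// -lt0n.
(* The deviation of [log2 |G_n|] from [D (2^n - 1)]. A linear bound on it suffices, as it gets
   divided by [2^n - 1]. *)
pose u n : R := ((n %/ r)%:R + (2 ^+ (n %% r) - 1) / (2 ^+ r - 1))%R.
have u_ge0 n : (0 <= u n)%R.
  by rewrite addr_ge0// divr_ge0 ?(ltW D0)// subr_ge0 exprn_ege1// ler1n.
have u_le n : (u n <= n.+1%:R)%R.
  rewrite -addn1 natrD lerD ?ler_nat ?leq_div// ler_pdivrMr// mul1r lerD2r.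
  by rewrite ler_weXn2l ?ler1n// ltnW// ltn_pmod.
apply: (@squeeze_cvgr _ _ _ _ (fun=> D) (fun n => D + n.+1%:R / (2 ^+ n - 1))%R).
- near=> n.
  (* The index 0 is left out because [2^n - 1] vanishes there. *)
  have n0 : (0 < n)%N by near: n; exact: nbhs_infty_gt.
  have p0 : (0 < 2 ^+ n - 1 :> R)%R.
    by rewrite subr_gt0 exprn_egt1 ?ltr1n// -lt0n.
  rewrite fin_image_closure card_fin_tree_aut log2_pow2 logN -/(u n) -/D.
  rewrite -subn1 natrB ?expn_gt0// natrX mulrDl mulfK ?gt_eqF//.
  rewrite lerDl divr_ge0 ?(ltW p0)//= lerD2l ler_pM2r ?invr_gt0//.
- exact: cvg_cst.
- rewrite -[X in _ --> X]addr0; apply: cvgD; first exact: cvg_cst.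
  exact: cvg_linear_over_pow2.
Unshelve. all: by end_near.
Qed.
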